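(* Let $n \ge 1$, let $P$ be a path and let $C$ be a caterpillar graph on the same vertex set of size $n$ (the path $P$ visits every vertex exactly once). Then $P$ and $C$ can be simultaneously embedded, i.e. have a $2$-layer geometric embedding, on an $n \times 2n$ grid.
   Context: Graphs are finite and simple. A caterpillar graph is a tree whose vertex set is the disjoint union of $V_p = \{p_1, \dots, p_{n'}\}$ (parent vertices) and $V_l$ (leg vertices, possibly empty), and whose edge set is the union of $E_p = \{p_1p_2, p_2p_3, \dots, p_{n'-1}p_{n'}\}$ (the spine path) and $E_l = \{\, p(l)\,l : l \in V_l \,\}$, where $p(l) \in V_p$ is the unique parent of the leg $l$. Let $G_i = (V, E_i)$, $1 \le i \le k$, be $k$ graphs on the same vertex set $V$ with possibly different edge sets. A $k$-layer geometric embedding (also called a simultaneous geometric embedding with mapping) of $G_1,\dots,G_k$ is an injective map $\phi : V \to \mathbb{R}^2$ such that, when every edge $uv$ is drawn as the straight segment $\overline{\phi(u)\phi(v)}$, for each $i$ the resulting drawing of $G_i$ is plane: two distinct edges of the same $E_i$ meet only at a common endpoint, and no edge of $E_i$ passes through the image of a vertex that is not one of its endpoints. Edges that do not both lie in a common $E_i$ may cross. The embedding is on an $a \times b$ grid if $\phi(V) \subseteq \{1,\dots,a\} \times \{1,\dots,b\}$ (up to an integer translation). *)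

(* Defs.v *)
From mathcomp Require Import all_boot all_order all_algebra.
From mathcomp Require Import classical_sets reals.

Set Implicit Arguments.
Unset Strict Implicit.
Unset Printing Implicit Defensive.

Import Order.TTheory GRing.Theory Num.Theory.
Local Open Scope ring_scope.

Record sgraph (V : finType) := SGraph {
  edge :> rel V;
  edge_sym : symmetric edge;
  edge_irrefl : irreflexive edge
}.

Definition consecutive (V : finType) (s : seq V) : rel V :=
  fun u v => infix [:: u; v] s || infix [:: v; u] s.

(* A path visits every vertex of V, so it is described by a duplicate-free
   enumeration of V. *)
Definition is_path (V : finType) (G : sgraph V) : Prop :=
  exists s : seq V, [/\ uniq s, forall v, v \in s & edge G =2 consecutive s].

Definition is_tree (V : finType) (G : sgraph V) : Prop :=
  [/\ (0 < #|V|)%N,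
      forall u v : V, connect G u v
    & forall c : seq V, ucycle G c -> (size c <= 2)%N].

(* The spine is the sequence p of parent vertices and the legs are all the
   vertices outside p; only the values of par on the legs are relevant. *)
Definition is_caterpillar (V : finType) (G : sgraph V) : Prop :=
  is_tree G /\
  exists (p : seq V) (par : V -> V),
    [/\ uniq p,
        forall l, l \notin p -> par l \in p
      & forall u v, edge G u v =
          [|| consecutive p u v,
              (u \notin p) && (v == par u)
            | (v \notin p) && (u == par v)]].

Definition segment (R : realType) (a b : R * R) : set (R * R) :=
  [set z : R * R | exists2 t : R, 0 <= t <= 1 &
     z = ((1 - t) * a.1 + t * b.1, (1 - t) * a.2 + t * b.2)]%classic.

Definition plane_drawing (R : realType) (V : finType) (G : sgraph V)
    (phi : V -> R * R) : Prop :=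
  (forall u v x y : V, G u v -> G x y -> [set u; v]%SET <> [set x; y]%SET ->
     forall z, segment (phi u) (phi v) z -> segment (phi x) (phi y) z ->
       exists w : V, [/\ w \in [set u; v]%SET, w \in [set x; y]%SET
                       & z = phi w]) /\
  (forall u v w : V, G u v -> segment (phi u) (phi v) (phi w) ->
     w \in [set u; v]%SET).

Definition layer_embedding (R : realType) (V : finType) (k : nat)
    (G : k.-tuple (sgraph V)) (phi : V -> R * R) : Prop :=
  injective phi /\ forall i : 'I_k, plane_drawing (tnth G i) phi.

(* (tx, ty) is the integer translation up to which the grid is taken. *)
Definition on_grid (R : realType) (V : finType) (a b : nat)
    (phi : V -> R * R) : Prop :=
  exists tx ty : int, forall v : V, exists i j : nat,
    [/\ (1 <= i <= a)%N, (1 <= j <= b)%N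
      & phi v = ((tx + i%:Z)%:~R, (ty + j%:Z)%:~R)].

(* Main.v *)
Require Import Defs.
From mathcomp Require Import all_boot all_order all_algebra.
From mathcomp Require Import classical_sets reals.
From mathcomp Require Import zify lra.

(** One coordinate of a vertex is its position in the path.  The other is its
    level in the caterpillar: the parent p_i and the legs of p_(i-1) are on
    level i.  In each layer every edge joins two consecutive levels of a
    coordinate, and all edges leaving a level upwards start at the same vertex.
    So the open strip between two levels contains a star only, and edges from
    different strips can meet only on a level, hence at vertices. *)

Import Order.TTheory GRing.Theory Num.Theory.

Section Drawing.
Set Implicit Arguments.
Unset Strict Implicit.
Local Open Scope ring_scope.
Variable R : realType.

Lemma segmentC (a b z : R * R) : segment a b z -> segment b a z.
Proof.
case=> t /andP[t0 t1] ->; exists (1 - t); first by apply/andP; split; lra.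
by congr (_, _); lra.
Qed.

Lemma segment_swap (a b z : R * R) :
  segment a b z -> segment (swap_pair a) (swap_pair b) (swap_pair z).
Proof. by case=> t t01 ->; exists t. Qed.

(** Reflection in the diagonal carries segments to segments. It is needed because levels are read
    off the first coordinate below, while those of the caterpillar are second coordinates. *)
Lemma plane_drawing_swap (V : finType) (G : sgraph V)
    (phi : V -> R * R) :
  plane_drawing G (fun v => swap_pair (phi v)) -> plane_drawing G phi.
Proof.
case=> cross thru; split=> [u v x y Guv Gxy ne z /segment_swap zuv
  /segment_swap zxy | u v w Guv /segment_swap]; last exact: thru.
have [w [wuv wxy zE]] := cross _ _ _ _ Guv Gxy ne _ zuv zxy.
by exists w; split=> //; case: z (phi w) zE {zuv zxy} => [? ?] [? ?] [-> ->].
Qed.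

Section LeveledDrawing.
Variables (V : finType) (G : sgraph V) (phi : V -> R * R).
Variable h : V -> nat.
Hypothesis phi_inj : injective phi.
Hypothesis phi1 : forall v, (phi v).1 = (h v)%:R.
Hypothesis edge_level : forall u v, edge G u v ->
  h v = (h u).+1 \/ h u = (h v).+1.
Hypothesis edge_bottom : forall u v x y, edge G u v -> edge G x y ->
  h v = (h u).+1 -> h y = (h x).+1 -> h u = h x -> u = x.

Let common u v x y z :=
  exists w : V, [/\ w \in [set u; v]%SET, w \in [set x; y]%SET & z = phi w].

Lemma phi_eq u v : h u = h v -> (phi u).2 = (phi v).2 -> u = v.
Proof.
move=> huv e; apply: phi_inj; rewrite [phi u]surjective_pairing.
by rewrite [phi v]surjective_pairing !phi1 huv e.
Qed.

(** With parameters [t] and [s] of [z] on the two edges, the first coordinates give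
    [h u + t = h x + s]. *)
Lemma upward_edges_meet u v x y z : edge G u v -> edge G x y ->
  h v = (h u).+1 -> h y = (h x).+1 -> (h u <= h x)%N ->
  [set u; v]%SET <> [set x; y]%SET ->
  segment (phi u) (phi v) z -> segment (phi x) (phi y) z ->
  common u v x y z.
Proof.
move=> Guv Gxy hv hy hux ne [t /andP[t0 t1] zt] [s /andP[s0 s1] zs].
have zts := etrans (esym zt) zs.
have := congr1 fst zts; have := congr1 snd zts; rewrite /= !phi1 hv hy.
rewrite -!(addn1 (h _)) !natrD => e2 e1.
move: hux; rewrite leq_eqVlt => /orP[/eqP hux|hux].
(* Same strip: the edges share their bottom and [s = t]. If [t] is nonzero, it cancels in the second
   coordinates, so the tops agree and the edges are equal. *)
- have ux := edge_bottom Guv Gxy hv hy hux; subst x.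
  have st : s = t by lra.
  subst s; have [t_eq0|tn0] := eqVneq t 0.
    exists u; rewrite !in_set2 eqxx; split=> //.
    by rewrite zt t_eq0 [RHS]surjective_pairing; congr (_, _); lra.
  have vy : v = y.
    apply: phi_eq; first by rewrite hv hy.
    by apply: (mulfI tn0); lra.
  by case: ne; rewrite vy.
(* Different strips: a level gap of at least 1 forces [t = 1] and [s = 0], so [z] is the top of one
   edge and the bottom of the other. *)
- have hux' : ((h u)%:R + 1 <= (h x)%:R :> R) by rewrite natr1 ler_nat.
  have t_eq1 : t = 1 by lra.
  have s_eq0 : s = 0 by lra.
  have hvx : h v = h x.
    by apply/eqP; rewrite -(eqr_nat R) hv -natr1; apply/eqP; lra.
  have vx : v = x by apply: phi_eq => //; move: e2; rewrite t_eq1 s_eq0; lra.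
  exists v; rewrite !in_set2 vx !eqxx orbT; split=> //.
  by rewrite zs s_eq0 [RHS]surjective_pairing; congr (_, _); lra.
Qed.

(** No integer lies strictly between the levels of [u] and [v], so [w] is on one of them and the
    parameter is 0 or 1. *)
Lemma upward_edge_vertex u v w : h v = (h u).+1 ->
  segment (phi u) (phi v) (phi w) -> w \in [set u; v]%SET.
Proof.
move=> hv [t /andP[t0 t1] wt].
have := congr1 fst wt; have := congr1 snd wt; rewrite /= !phi1 hv -natr1.
move=> e2 e1.
have huw : (h u <= h w)%N by rewrite -(ler_nat R); lra.
have hwv : (h w <= h v)%N by rewrite -(ler_nat R) hv -natr1; lra.
rewrite in_set2; apply/orP.
have [hw|hw] : h w = h u \/ h w = h v by lia.
- left; apply/eqP/phi_eq => //; rewrite hw in e1.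
  by have t_eq0 : t = 0 by [lra]; rewrite e2 t_eq0; lra.
- right; apply/eqP/phi_eq => //; rewrite hw hv -natr1 in e1.
  by have t_eq1 : t = 1 by [lra]; rewrite e2 t_eq1; lra.
Qed.

Lemma leveled_plane_drawing : plane_drawing G phi.
Proof.
split=> [u v x y Guv Gxy ne z zuv zxy|u v w Guv wuv]; last first.
  case: (edge_level Guv) => hv; first exact: upward_edge_vertex wuv.
  by rewrite finset.setUC; apply: upward_edge_vertex (segmentC wuv).
wlog hv : u v Guv ne zuv / h v = (h u).+1 => [IH|].
  have [hv|hv] := edge_level Guv; first exact: IH.
  rewrite finset.setUC; apply: IH hv; rewrite 1?edge_sym 1?finset.setUC //.
  exact: segmentC.
wlog hy : x y Gxy ne zxy / h y = (h x).+1 => [IH|].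
  have [hy|hy] := edge_level Gxy; first exact: IH.
  rewrite [[set x; y]%SET]finset.setUC; apply: IH hy; rewrite 1?edge_sym //.
    by rewrite [[set y; x]%SET]finset.setUC.
  exact: segmentC.
have [hux|/ltnW hxu] := leqP (h u) (h x); first exact: upward_edges_meet.
have [|w [wxy wuv zw]] := upward_edges_meet Gxy Guv hy hv hxu _ zxy zuv.
  exact/nesym.
by exists w.
Qed.

End LeveledDrawing.

End Drawing.

Section Caterpillar.
Set Implicit Arguments.
Unset Strict Implicit.

Lemma infix2_index (T : eqType) (s : seq T) (u v : T) :
  uniq s -> infix [:: u; v] s ->
  [/\ u \in s, v \in s & index v s = (index u s).+1].
Proof.
move=> us /infixP[s1 [s2 sE]]; move: us; rewrite sE cat_uniq /= !inE !negb_or.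
case/and5P=> _ /andP[/negbTE us1 /andP[/negbTE vs1 _]] /andP[uv _] _ _.
rewrite !mem_cat !index_cat us1 vs1 /= !inE !eqxx !orbT (negbTE uv).
by split=> //; rewrite addn0 addn1.
Qed.

Lemma consecutive_index (V : finType) (s : seq V) (u v : V) :
  uniq s -> consecutive s u v ->
  [/\ u \in s, v \in s &
      index v s = (index u s).+1 \/ index u s = (index v s).+1].
Proof.
by move=> us /orP[] /(infix2_index us)[? ? ?]; split=> //; [left|right].
Qed.

Definition caterpillar_level (V : eqType) (p : seq V) (par : V -> V) (v : V) :=
  if v \in p then (index v p).+1 else (index (par v) p).+2.

(** Besides the level step, the lower end is recorded to be a parent vertex: legs may share a level
    with each other and with a parent vertex, but parent vertices have distinct levels. *)
Lemma caterpillar_edge_level (V : finType) (p : seq V) (par : V -> V) (u v : V) :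
  uniq p -> (forall l, l \notin p -> par l \in p) ->
  [|| consecutive p u v, (u \notin p) && (v == par u)
    | (v \notin p) && (u == par v)] ->
  let h := caterpillar_level p par in
  (h v = (h u).+1 /\ u \in p) \/ (h u = (h v).+1 /\ v \in p).
Proof.
move=> up parP; rewrite /caterpillar_level.
case/or3P=> [|/andP[l /eqP->]|/andP[l /eqP->]].
- by case/(consecutive_index up)=> -> -> [] ->; [left|right].
- by right; rewrite (negbTE l) (parP _ l).
- by left; rewrite (negbTE l) (parP _ l).
Qed.

End Caterpillar.

Theorem theorem4 (R : realType) (n : nat) (V : finType) (P C : sgraph V) :
  (1 <= n)%N -> #|V| = n -> is_path P -> is_caterpillar C ->
  exists phi : V -> R * R,
    layer_embedding [tuple P; C] phi /\ on_grid n (2 * n) phi.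
Proof.
move=> _ cardV [s [us sP edgeP]] [_ [p [par [up parP edgeC]]]].
pose x v := (index v s).+1; pose y := caterpillar_level p par.
pose phi v : R * R := ((x v)%:R, (y v)%:R)%R.
have x_inj u v : x u = x v -> u = v by case; apply: index_inj.
have phi_inj : injective phi.
  by move=> u v [/eqP]; rewrite eqr_nat => /eqP /x_inj.
exists phi; split; last first.
  exists 0%R, 0%R => v; exists (x v), (y v).
  have := uniq_leq_size us (fun z _ => mem_enum predT z).
  have := uniq_leq_size up (fun z _ => mem_enum predT z).
  rewrite -cardE cardV => size_p size_s.
  split; last by rewrite !add0r -!pmulrn.
    by have := sP v; rewrite -index_mem /x; lia.
  (* A leg has level at most [size p + 1], hence at most [n + 1], which is within [2 * n] because
     [p] contains its parent and so [n] is positive. *)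
  rewrite /y /caterpillar_level; case: ifPn => [|/parP]; rewrite -index_mem; lia.
split=> // i; case: i => [[|[|//]] ?]; rewrite (tnth_nth P) /=.
(* In the path each level holds a single vertex, so the bottom of an edge is determined by its
   level. *)
- apply: (@leveled_plane_drawing _ _ _ _ x) => // [u v|u v a b _ _ _ _ /x_inj//].
  by rewrite edgeP => /(consecutive_index us)[_ _ []] /=;
    rewrite /x => ->; [left|right].
- apply: plane_drawing_swap; apply: (@leveled_plane_drawing _ _ _ _ y) => //.
  + by move=> u v [] yuv xuv; apply: phi_inj; rewrite /phi yuv xuv.
  + move=> u v; rewrite edgeC.
    by case/(caterpillar_edge_level up parP)=> -[]; [left|right].
  (* Both bottoms lie in [p], where the level is the index plus one and thus determines the
     vertex. *)
  + have bottom u v : edge C u v -> y v = (y u).+1 -> u \in p.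
      rewrite edgeC => /(caterpillar_edge_level up parP) [[]//|[]].
      by rewrite -/y; lia.
    move=> u v a b Cuv Cab yv yb; have := bottom _ _ Cab yb.
    have := bottom _ _ Cuv yv; rewrite /y /caterpillar_level => pu pa.
    by rewrite pu pa => -[]; apply: index_inj.
Qed.
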